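(* Let $A$ be an octonion division algebra over a field $F$ and let $\phi(z)=z^n+c_{n-1}z^{n-1}+\dots+c_1z+c_0$ be a standard monic polynomial over $A$, $n\ge 1$, with companion polynomial $\Phi(z)$ and companion matrix $C_\phi$. Then $R(\Phi)=REV(C_\phi)$.
   Context: $F$ is a field of arbitrary characteristic. An octonion algebra over $F$ is an algebra $A=Q\oplus Q\ell$, where $Q$ is a quaternion algebra over $F$ with its canonical symplectic involution $\bar{\ }$, $\ell^2\in F^\times$, and multiplication is $(p+q\ell)(r+s\ell)=pr+\ell^2\bar{s}q+(sp+q\bar{r})\ell$. The involution extends to $A$ by $\overline{p+q\ell}=\overline{p}-q\ell$. The norm form $\operatorname{Norm}(x)=\overline{x}\cdot x$ and the trace form $\operatorname{Tr}(x)=x+\overline{x}$ take values in $F$. $A$ is alternative; it is a division algebra if and only if its norm form is anisotropic. A standard polynomial over $A$ has its coefficients in $A$ on the left of the variable. The companion polynomial of $\phi$ (with $c_n=1$) is $\Phi(z)=b_{2n}z^{2n}+\dots+b_1z+b_0$ where, for $k\in\{0,\dots,2n\}$: if $k$ is odd, $b_k$ is the sum of all $\operatorname{Tr}(\overline{c_i}c_j)$ with $0\le i<j\le n$ and $i+j=k$; if $k=2m$ is even, $b_k$ is the sum of all $\operatorname{Tr}(\overline{c_i}c_j)$ with $0\le i<j\le n$ and $i+j=k$, plus $\operatorname{Norm}(c_m)$. The $b_k$ lie in $F$; $R(\Phi)=\{\lambda\in A: \sum_k b_k\lambda^k=0\}$ is the set of roots of $\Phi$ in $A$. The companion matrix $C_\phi$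 is the $n\times n$ matrix over $A$ with $1$'s in positions $(i,i+1)$ for $1\le i\le n-1$, last row $(-c_0,-c_1,\dots,-c_{n-1})$, and zeros elsewhere. A right eigenvalue of $C_\phi$ is an element $\lambda\in A$ such that $C_\phi v=v\lambda$ for some nonzero column vector $v\in A^n$ (where $v\lambda$ is the entrywise right multiple by $\lambda$); $REV(C_\phi)$ is the set of right eigenvalues. *)

(* Defs.v *)
From HB Require Import structures.
From mathcomp Require Import all_boot all_order all_algebra all_field.
From mathcomp Require Import classical_sets.

Set Implicit Arguments.
Unset Strict Implicit.
Unset Printing Implicit Defensive.

Import GRing.Theory.
Local Open Scope ring_scope.
Local Open Scope vspace_scope.

(* Central simple of dimension 4, in every characteristic; the third clause
   says that a two-sided ideal I is trivial. *)
Definition is_quaternion_algebra (F : fieldType) (Q : falgType F) : Prop :=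
  [/\ \dim {:Q} = 4%N,
      'Z({:Q}) = 1%VS
    & forall I : {vspace Q},
        ({:Q} * I <= I)%VS -> (I * {:Q} <= I)%VS -> I = 0%VS \/ I = fullv].

(* On a quaternion algebra there is exactly one such map, x |-> Trd(x) - x.
   The subspace 1%VS is the line F.1. *)
Definition is_canonical_involution (F : fieldType) (Q : falgType F)
    (conj : {linear Q -> Q}) : Prop :=
  [/\ forall x y, conj (x * y)%R = (conj y * conj x)%R,
      forall x, conj (conj x) = x,
      forall x, (x + conj x)%R \in 1%VS
    & forall x, (conj x * x)%R \in 1%VS].

Local Close Scope vspace_scope.

(* The pair (p, q) stands for p + q l, where l^2 = gamma. This alias keeps the
   vector space structure of Q * Q but not its componentwise ring structure. *)
Definition octonion (F : fieldType) (Q : falgType F)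
  (conj : {linear Q -> Q}) (gamma : F) : Type := (Q * Q)%type.

HB.instance Definition _ (F : fieldType) (Q : falgType F)
  (conj : {linear Q -> Q}) (gamma : F) :=
  Vector.on (octonion conj gamma).

Section Octonion.
Variables (F : fieldType) (Q : falgType F).
Variables (conj : {linear Q -> Q}) (gamma : F).
Local Notation A := (octonion conj gamma).

Definition oct_one : A := (1, 0).

Definition oct_mul (x y : A) : A :=
  let: (p, q) := x in let: (r, s) := y in
  (p * r + gamma *: (conj s * q), s * p + q * conj r).

Definition oct_conj (x : A) : A := let: (p, q) := x in (conj p, - q).

(* The product is only alternative, but the powers of a single element do not
   depend on the bracketing. *)
Definition oct_exp (x : A) (k : nat) : A := iter k (oct_mul x) oct_one.

(* Both forms take values in the line F.1 of A, with which F is identified. *)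
Definition oct_norm (x : A) : A := oct_mul (oct_conj x) x.
Definition oct_trace (x : A) : A := x + oct_conj x.

Definition oct_division : Prop :=
  forall a b : A, a != 0 ->
    (exists! x, oct_mul a x = b) /\ (exists! y, oct_mul y a = b).

Section MonicPolynomial.
Variables (n : nat) (c : 'I_n -> A).

Definition monic_coef (i : nat) : A :=
  if insub i is Some j then c j else if i == n then oct_one else 0.

Definition companion_coef (k : nat) : A :=
  \sum_(i < n.+1) \sum_(j < n.+1 | (i < j)%N && (i + j == k)%N)
     oct_trace (oct_mul (oct_conj (monic_coef i)) (monic_coef j))
  + (if odd k then 0 else oct_norm (monic_coef k./2)).

Definition companion_roots : set A :=
  [set lam : A |
    \sum_(k < (2 * n).+1) oct_mul (companion_coef k) (oct_exp lam k) = 0].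

Definition companion_mx : 'M[A]_n :=
  \matrix_(i < n, j < n)
    if i.+1 == n then - c j else if j == i.+1 :> nat then oct_one else 0.

End MonicPolynomial.

Definition oct_mulmxv (n : nat) (M : 'M[A]_n) (v : 'cV[A]_n) : 'cV[A]_n :=
  \col_(i < n) \sum_(j < n) oct_mul (M i j) (v j 0).

Definition oct_scalerv (n : nat) (v : 'cV[A]_n) (lam : A) : 'cV[A]_n :=
  \col_(i < n) oct_mul (v i 0) lam.

Definition right_eigenvalues (n : nat) (M : 'M[A]_n) : set A :=
  [set lam : A |
    exists2 v : 'cV[A]_n, v != 0 & oct_mulmxv M v = oct_scalerv v lam].

End Octonion.

(* Main.v *)
From HB Require Import structures.
Require Import Defs.
From mathcomp Require Import all_boot all_order all_algebra all_field.
From mathcomp Require Import ring.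
From mathcomp Require Import classical_sets.

Set Implicit Arguments.
Unset Strict Implicit.
Unset Printing Implicit Defensive.

Import GRing.Theory.
Local Open Scope ring_scope.

(** The right eigenvalues and the roots of the companion polynomial are compared
    through one linear operator on the octonion algebra A.

    Every power of lam is a combination a_k lam + d_k with a_k, d_k in F, and
    w lam^k = a_k (w lam) + d_k w because A is alternative. Put
    P = sum_j a_j c_j and D = sum_j d_j c_j, with c_n = 1 ([rem_lead],
    [rem_const]). The first n - 1 rows of the equation C v = v lam say that v
    is the column of the w lam^i, where w is its first entry, and the last row
    then reads P (w lam) + D w = 0 ([right_eigenvalueP],
    [sum_monic_coef_exp]). On the other side, reducing the companion
    polynomial modulo the quadratic equation lam^2 = t lam - N(lam), with
    t = Tr(lam), gives ([companion_eval])

      Phi(lam) = (B(P, D) + t N(P)) lam + (N(D) - N(lam) N(P)),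

    where B is the polar form of the norm N. So it remains to show that this
    element vanishes exactly when S(w) = P (w lam) + D w has a nontrivial
    kernel.

    If S(w) = 0 with w nonzero, so that D w = - P (w lam), multiplicativity of
    the norm and its polarizations give N(D) = N(P) N(lam) and
    B(P, D) = - t N(P), hence Phi(lam) = 0 ([pencil_norm_eq0]).

    Conversely, w0 = conj(P) lam + conj(D) always satisfies S(w0) = Phi(lam)
    ([pencil_conj]); when Phi(lam) = 0 and w0 is nonzero it is the required
    vector. When w0 = 0, the polarized identity
    x (conj(y) z) + y (conj(x) z) = B(x, y) z gives

      S(y) = S(y) + conj(y) w0 = B(P, conj y) lam + B(D, conj y),

    so S maps the 8-dimensional space A into the span of lam and 1 and has a
    nontrivial kernel ([pencilE], [pencil_ker]). *)

(** * The norm of an algebra with involution *)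

Section ScalarPart.
Variables (F : fieldType) (Q : falgType F).

(** The value in F of an element of the line spanned by 1, extended linearly
    to Q by the coordinate function of the one-element family (1). *)
Definition scalar_part : Q -> F := coord [tuple (1 : Q)] ord0.

HB.instance Definition _ := GRing.Linear.on scalar_part.

Lemma scalar_partE (x : Q) : x \in 1%VS -> x = (scalar_part x)%:A.
Proof.
move=> x1; have := @coord_span F Q 1 [tuple (1 : Q)] x.
by rewrite span_seq1 big_ord1; apply.
Qed.

Lemma scalar_part_alg k : scalar_part k%:A = k.
Proof.
have k1 : (k%:A : Q) \in 1%VS by apply/vlineP; exists k.
apply/eqP; rewrite -subr_eq0; have /eqP := scalar_partE k1.
by rewrite eq_sym -subr_eq0 -scalerBl scaler_eq0 oner_eq0 orbF.
Qed.

End ScalarPart.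

Section InvolutionNorm.
Variables (F : fieldType) (Q : falgType F) (conj : {linear Q -> Q}).
Hypothesis conjP : is_canonical_involution conj.

Let conjM x y : conj (x * y) = conj y * conj x.
Proof. by case: conjP. Qed.

Let conjK x : conj (conj x) = x.
Proof. by case: conjP. Qed.

Lemma conj1 : conj 1 = 1.
Proof. by rewrite -[LHS]mulr1 -[X in _ * X]conjK -conjM mulr1 conjK. Qed.

(** The F-valued norm: conj x * x = (qnorm x)%:A. *)
Definition qnorm x : F := scalar_part (conj x * x).

Lemma conj_mul x : conj x * x = (qnorm x)%:A.
Proof. by apply: scalar_partE; case: conjP. Qed.

Lemma mul_conj x : x * conj x = (qnorm x)%:A.
Proof.
have tr : x + conj x = (scalar_part (x + conj x))%:A.
  by apply: scalar_partE; case: conjP.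
(* As x + conj x is a scalar, x commutes with conj x. *)
rewrite -conj_mul; apply: (@addrI _ (x * x)).
rewrite -mulrDr -mulrDl tr.
by rewrite -scalerAr -scalerAl mulr1 mul1r.
Qed.

Lemma qnorm_conj x : qnorm (conj x) = qnorm x.
Proof. by rewrite /qnorm conjK mul_conj scalar_part_alg. Qed.

Lemma qnormZ a x : qnorm (a *: x) = a ^+ 2 * qnorm x.
Proof.
by rewrite /qnorm linearZ -scalerAl -scalerAr scalerA linearZ.
Qed.

Lemma qnormM x y : qnorm (x * y) = qnorm x * qnorm y.
Proof.
rewrite [LHS]/qnorm conjM -mulrA (mulrA (conj x)) conj_mul -scalerAl mul1r.
by rewrite -scalerAr conj_mul scalerA scalar_part_alg.
Qed.

(** The polar form of [qnorm]. *)
Definition qpolar x y : F := scalar_part (conj x * y + conj y * x).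

Lemma qnormD x y : qnorm (x + y) = qnorm x + qnorm y + qpolar x y.
Proof.
rewrite /qnorm /qpolar linearD /= mulrDl !mulrDr -!linearD; congr scalar_part.
by rewrite [conj y * x + _]addrC addrACA.
Qed.

Lemma qpolarP x k y z :
  qpolar x (k *: y + z) = k * qpolar x y + qpolar x z.
Proof.
rewrite /qpolar linearP mulrDr mulrDl -scalerAr -scalerAl addrACA -scalerDr.
by rewrite linearP.
Qed.

Lemma qpolarZ x k y : qpolar x (k *: y) = k * qpolar x y.
Proof.
by rewrite /qpolar linearZ -scalerAl -scalerAr -scalerDr linearZ.
Qed.

(** The norm is invariant under conj, and so is its polar form. *)
Lemma qpolarE x y : qpolar x y = scalar_part (y * conj x + x * conj y).
Proof.
have := qnormD (conj x) (conj y).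
rewrite -linearD !qnorm_conj qnormD => /addrI ->.
by rewrite /qpolar !conjK addrC.
Qed.

End InvolutionNorm.

(** * The norm of the octonion algebra *)

Section OctonionNorm.
Variables (F : fieldType) (Q : falgType F) (conj : {linear Q -> Q}).
Variable gamma : F.
Hypothesis conjP : is_canonical_involution conj.
Local Notation A := (octonion conj gamma).
Local Notation "x ** y" := (oct_mul (x : A) (y : A)) (at level 40).
Local Notation "''1'" := (oct_one conj gamma).
Local Notation cj := (@oct_conj F Q conj gamma).

Implicit Types (x y z : A).

Lemma oct_ext x y : x.1 = y.1 -> x.2 = y.2 -> x = y.
Proof. by case: x y => [p q] [r s] /= -> ->. Qed.

Lemma oct_mulDl x y z : (x + y) ** z = x ** z + y ** z.
Proof.
case: x y z => [p q] [r s] [u v]; apply: oct_ext => /=.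
  by rewrite mulrDl mulrDr scalerDr addrACA.
by rewrite mulrDr mulrDl addrACA.
Qed.

Lemma oct_mulDr x y z : z ** (x + y) = z ** x + z ** y.
Proof.
case: x y z => [p q] [r s] [u v]; apply: oct_ext => /=.
  by rewrite linearD mulrDl mulrDr scalerDr addrACA.
by rewrite linearD mulrDr mulrDl addrACA.
Qed.

Lemma oct_mulZl k x y : (k *: x) ** y = k *: (x ** y).
Proof.
case: x y => [p q] [r s]; apply: oct_ext => /=.
  by rewrite scalerDr -!scalerAl -scalerAr !scalerA mulrC.
by rewrite scalerDr -scalerAr -scalerAl.
Qed.

Lemma oct_mulZr k x y : x ** (k *: y) = k *: (x ** y).
Proof.
case: x y => [p q] [r s]; apply: oct_ext => /=.
  by rewrite scalerDr linearZ /= -!scalerAr -scalerAl !scalerA mulrC.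
by rewrite scalerDr linearZ /= -scalerAr -scalerAl.
Qed.

Fact oct_mul_linear x : linear (oct_mul x : A -> A).
Proof. by move=> k y z; rewrite oct_mulDr oct_mulZr. Qed.

HB.instance Definition _ x :=
  GRing.isLinear.Build F A A *:%R (oct_mul x) (oct_mul_linear x).

Lemma oct_mul0l x : 0 ** x = 0.
Proof. by rewrite -[in LHS](scale0r x) oct_mulZl scale0r. Qed.

Lemma oct_mul_suml I r (P : pred I) (G : I -> A) y :
  (\sum_(i <- r | P i) G i) ** y = \sum_(i <- r | P i) G i ** y.
Proof.
apply: (big_morph (fun x : A => x ** y)) => [x z|]; first exact: oct_mulDl.
exact: oct_mul0l.
Qed.

Lemma oct_mul1l x : '1 ** x = x.
Proof.
case: x => [p q]; apply: oct_ext => /=.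
  by rewrite mul1r mulr0 scaler0 addr0.
by rewrite mulr1 mul0r addr0.
Qed.

Lemma oct_mul1r x : x ** '1 = x.
Proof.
case: x => [p q]; apply: oct_ext => /=.
  by rewrite linear0 mul0r scaler0 mulr1 addr0.
by rewrite mul0r (conj1 conjP) mulr1 add0r.
Qed.

Fact oct_conj_linear : linear cj.
Proof.
move=> k [p q] [r s]; apply: oct_ext => /=; first by rewrite linearP.
by rewrite opprD scalerN.
Qed.

HB.instance Definition _ :=
  GRing.isLinear.Build F A A *:%R cj oct_conj_linear.

Lemma oct_conjK : involutive cj.
Proof.
by move=> [p q]; apply: oct_ext => /=; [case: conjP | rewrite opprK].
Qed.

Lemma oct_conj1 : cj '1 = '1.
Proof. by apply: oct_ext; rewrite /= ?oppr0 ?(conj1 conjP). Qed.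

Lemma oct_conjM x y : cj (x ** y) = cj y ** cj x.
Proof.
have [conjM conjK _ _] := conjP.
case: x y => [p q] [r s]; apply: oct_ext => /=.
  by rewrite linearD linearZ /= !conjM conjK linearN mulNr mulrN opprK.
by rewrite conjK mulNr addrC mulNr opprD.
Qed.

(** The F-valued norm N of the octonion algebra. *)
Definition oct_qnorm x : F := qnorm conj x.1 - gamma * qnorm conj x.2.

Lemma oct_normE x : oct_norm x = oct_qnorm x *: '1.
Proof.
have [conjM conjK _ _] := conjP.
case: x => [p q]; rewrite /oct_norm; apply: oct_ext => /=.
  by rewrite (conj_mul conjP) mulrN (conj_mul conjP) scalerN scalerA -scalerBl.
by rewrite mulNr subrr scaler0.
Qed.

Lemma oct_mulKr x z : x ** (cj x ** z) = oct_qnorm x *: z.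
Proof.
have [conjM conjK _ _] := conjP.
case: x z => [p q] [r s]; apply: oct_ext => /=.
  rewrite mulrDr mulrA (mul_conj conjP) mulrN scalerN mulrN -scalerAr.
  rewrite -scalerAl mul1r linearD /= conjM conjK mulNr linearN conjM conjK.
  rewrite mulrDl mulNr scalerDr mulrA addrA addrNK -mulrA (conj_mul conjP).
  by rewrite -scalerAr mulr1 scalerN scalerA -scalerBl.
rewrite mulrDl linearD mulrDr mulNr mulrN scalerN linearN linearZ /= !conjM.
rewrite !conjK -mulrA (conj_mul conjP) -scalerAr mulr1 mulNr -!mulrA.
rewrite addrA addrNK mulrN -scalerAr mulrA (mul_conj conjP) -scalerAl mul1r.
by rewrite scalerA -scalerBl.
Qed.

Lemma oct_mulrK x z : (z ** x) ** cj x = oct_qnorm x *: z.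
Proof.
apply: (can_inj oct_conjK); rewrite !oct_conjM oct_conjK.
by rewrite oct_mulKr linearZ.
Qed.

Lemma oct_qnormM x y : oct_qnorm (x ** y) = oct_qnorm x * oct_qnorm y.
Proof.
have [conjM conjK _ _] := conjP.
case: x y => [p q] [r s]; rewrite /oct_qnorm /= !qnormD // !qnormZ.
rewrite !qnormM // !qnorm_conj //.
(* With m = conj p * conj s * q, the two polar terms are the traces of
   conj r * m and of m * conj r, up to the factor gamma; these agree by
   [qpolarE]. *)
suff -> : qpolar conj (p * r) (gamma *: (conj s * q)) =
          gamma * qpolar conj (s * p) (q * conj r) by ring.
have polar_r := qpolarE conjP r (conj p * conj s * q).
rewrite qpolarZ; congr (_ * _); move: polar_r.
by rewrite /qpolar !conjM !conjK !mulrA.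
Qed.

Lemma oct_qnormZ k x : oct_qnorm (k *: x) = k ^+ 2 * oct_qnorm x.
Proof. by rewrite /oct_qnorm /= !qnormZ; ring. Qed.

(** The polar form B of the norm; [oct_polar '1 x] is the trace of x. *)
Definition oct_polar x y : F := oct_qnorm (x + y) - oct_qnorm x - oct_qnorm y.

Lemma oct_qnormD x y :
  oct_qnorm (x + y) = oct_qnorm x + oct_qnorm y + oct_polar x y.
Proof. by rewrite /oct_polar; ring. Qed.

Let oct_qnormDZ x y z : oct_qnorm (x + y) *: z =
  oct_qnorm x *: z + oct_qnorm y *: z + oct_polar x y *: z.
Proof. by rewrite oct_qnormD !scalerDl. Qed.

Lemma oct_polarC x y : oct_polar x y = oct_polar y x.
Proof. by rewrite /oct_polar [y + x]addrC; ring. Qed.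

Lemma oct_polarE x y :
  oct_polar x y = qpolar conj x.1 y.1 - gamma * qpolar conj x.2 y.2.
Proof. by rewrite /oct_polar /oct_qnorm /= !qnormD; ring. Qed.

Fact oct_polar_linear x : linear (oct_polar x : A -> F^o).
Proof.
by move=> k y z; rewrite /GRing.scale /= !oct_polarE /= !qpolarP; ring.
Qed.

HB.instance Definition _ x :=
  GRing.isLinear.Build F A F^o *:%R (oct_polar x) (oct_polar_linear x).

Lemma oct_polarZr k x y : oct_polar x (k *: y) = k * oct_polar x y.
Proof. exact: linearZ. Qed.

Lemma oct_polar_trace x y : oct_trace (cj x ** y) = oct_polar x y *: '1.
Proof.
have : oct_norm (x + y) = oct_norm x + oct_norm y + oct_trace (cj x ** y).
  rewrite /oct_norm /oct_trace (linearD cj) oct_mulDl !oct_mulDr.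
  rewrite oct_conjM oct_conjK.
  by rewrite [cj y ** x + _]addrC addrACA.
by rewrite !oct_normE oct_qnormDZ => /addrI.
Qed.

Lemma oct_mulKrD x y z :
  x ** (cj y ** z) + y ** (cj x ** z) = oct_polar x y *: z.
Proof.
have := oct_mulKr (x + y) z.
rewrite (linearD cj) !oct_mulDl !oct_mulDr [y ** _ + _]addrC addrACA !oct_mulKr.
by rewrite oct_qnormDZ => /addrI.
Qed.

Lemma oct_mulrKD x y z :
  (z ** y) ** cj x + (z ** x) ** cj y = oct_polar x y *: z.
Proof.
have := oct_mulrK (x + y) z.
rewrite (linearD cj) !oct_mulDr !oct_mulDl [(z ** x) ** cj y + _]addrC addrACA.
by rewrite !oct_mulrK oct_qnormDZ => /addrI.
Qed.

Lemma oct_polar_mull x y z :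
  oct_polar (x ** y) (x ** z) = oct_qnorm x * oct_polar y z.
Proof. by rewrite /oct_polar -oct_mulDr !oct_qnormM; ring. Qed.

Lemma oct_polar_mulr x y z :
  oct_polar (y ** x) (z ** x) = oct_polar y z * oct_qnorm x.
Proof. by rewrite /oct_polar -oct_mulDl !oct_qnormM; ring. Qed.

(** The quadratic equation of x, in the form given by right alternativity. *)
Lemma oct_mulrr x z :
  (z ** x) ** x = oct_polar '1 x *: (z ** x) - oct_qnorm x *: z.
Proof.
rewrite -oct_mulrKD oct_conj1 oct_mul1r -oct_mulrK.
by rewrite oct_mul1r addrK.
Qed.

Lemma oct_qnorm_eq0 x : oct_division conj gamma -> oct_qnorm x = 0 -> x = 0.
Proof.
move=> divA Nx0; apply/eqP; apply: contraT => x_neq0.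
(* Both 0 and the conjugate of x annihilate x on the left. *)
have [_ [y [_ y_uniq]]] := divA x 0 x_neq0.
have mulcx : cj x ** x = 0 by rewrite -/(oct_norm x) oct_normE Nx0 scale0r.
have cx0 : cj x = 0 by rewrite -(y_uniq _ mulcx) (y_uniq _ (oct_mul0l x)).
by rewrite -[x]oct_conjK cx0 linear0 eqxx in x_neq0.
Qed.

(** * Powers of an octonion *)

Local Arguments oct_mul : simpl never.
Local Arguments oct_conj : simpl never.

Section Powers.
Variable x : A.

(** The pair (a, d) with x^k = a x + d, obtained from x^2 = Tr(x) x - N(x). *)
Fixpoint exp_coef (k : nat) : F * F :=
  if k is k'.+1 then
    let: (a, d) := exp_coef k' in
    (d + oct_polar '1 x * a, - (oct_qnorm x * a))
  else (0, 1).

Lemma oct_expE k : oct_exp x k = (exp_coef k).1 *: x + (exp_coef k).2 *: '1.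
Proof.
have sqr : x ** x = oct_polar '1 x *: x - oct_qnorm x *: '1.
  by have := oct_mulrr x '1; rewrite !oct_mul1l.
elim: k => [|k IHk] /=; first by rewrite scale0r scale1r add0r.
rewrite -/(oct_exp x k) IHk; case: (exp_coef k) => a d /=.
rewrite oct_mulDr !oct_mulZr oct_mul1r sqr scalerBr !scalerA scalerDl scaleNr.
by rewrite addrAC [d *: x + _]addrC ![a * _]mulrC.
Qed.

Lemma oct_mul_exp w k :
  w ** oct_exp x k = (exp_coef k).1 *: (w ** x) + (exp_coef k).2 *: w.
Proof. by rewrite oct_expE oct_mulDr !oct_mulZr oct_mul1r. Qed.

Lemma oct_mul_expSr w k : w ** oct_exp x k.+1 = (w ** oct_exp x k) ** x.
Proof.
rewrite !oct_mul_exp /=; case: (exp_coef k) => a d /=.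
rewrite oct_mulDl !oct_mulZl oct_mulrr scalerBr !scalerA scalerDl scaleNr.
by rewrite [RHS]addrAC [d *: _ + _]addrC ![a * _]mulrC.
Qed.

Lemma exp_coefD i j :
  let: (a, d) := exp_coef i in let: (b, e) := exp_coef j in
  exp_coef (i + j) =
    (a * e + d * b + oct_polar '1 x * (a * b), d * e - oct_qnorm x * (a * b)).
Proof.
elim: i => [|i] /=; first by case: (exp_coef j) => b e; congr (_, _); ring.
case: (exp_coef i) (exp_coef j) => [a d] [b e] ->.
by congr (_, _); ring.
Qed.

End Powers.

(** * The norm of a linear combination *)

(** The expansion of the norm of a linear combination of the u i, with the
    scalar h i j in place of the product of the i-th and j-th coefficients. For
    h i j = f (i + j) it is the image of the companion polynomial under the
    linear map sending z^k to f k. *)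
Definition polarized_sum m (u : nat -> A) (h : nat -> nat -> F) : F :=
  \sum_(i < m) oct_qnorm (u i) * h i i +
  \sum_(i < m) \sum_(j < m | (i < j)%N) oct_polar (u i) (u j) * h i j.

Lemma polarized_sumP m u k h1 h2 :
  polarized_sum m u (fun i j => k * h1 i j + h2 i j) =
  k * polarized_sum m u h1 + polarized_sum m u h2.
Proof.
rewrite /polarized_sum mulrDr !mulr_sumr addrACA -!big_split.
apply: eq_bigr => i _ /=; congr (_ + _); first by ring.
by rewrite mulr_sumr -big_split; apply: eq_bigr => j _ /=; ring.
Qed.

Lemma eq_polarized_sum m u h1 h2 : h1 =2 h2 ->
  polarized_sum m u h1 = polarized_sum m u h2.
Proof.
move=> eq_h; rewrite /polarized_sum; congr (_ + _).
  by apply: eq_bigr => i _; rewrite eq_h.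
apply: eq_bigr => i _.
by apply: eq_bigr => j _; rewrite eq_h.
Qed.

Lemma oct_qnorm_sum m (g : nat -> F) (u : nat -> A) :
  oct_qnorm (\sum_(i < m) g i *: u i) =
  polarized_sum m u (fun i j => g i * g j).
Proof.
rewrite /polarized_sum; elim: m => [|m IHm].
  rewrite !big_ord0 addr0 -[X in oct_qnorm X](scale0r '1) oct_qnormZ.
  by rewrite expr0n mul0r.
rewrite !big_ord_recr /= oct_qnormD IHm oct_qnormZ.
rewrite [X in _ = _ + (_ + X)]big_pred0 => [|j]; last first.
  by rewrite ltnNge -ltnS ltn_ord.
rewrite addr0 oct_polarC linear_sum /=.
transitivity (\sum_(i < m) oct_qnorm (u i) * (g i * g i) +
  \sum_(i < m) \sum_(j < m | (i < j)%N) oct_polar (u i) (u j) * (g i * g j) +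
  oct_qnorm (u m) * (g m * g m) +
  \sum_(i < m) oct_polar (u i) (u m) * (g i * g m)).
  congr (_ + _ + _); first by ring.
  by apply: eq_bigr => i _; rewrite oct_polarZr oct_polarC oct_polarZr; ring.
rewrite -!addrA; congr (_ + _); rewrite addrCA; congr (_ + _).
rewrite -big_split; apply: eq_bigr => i _ /=.
by rewrite [RHS]big_mkcond big_ord_recr /= ltn_ord -big_mkcond.
Qed.

(** * The operator attached to a linear polynomial *)

Section Pencil.
Variables (P D x : A).

(** Evaluation of the linear polynomial P z + D at x, twisted by w. *)
Definition pencil w := P ** (w ** x) + D ** w.

(** The value at x of the companion polynomial N(P) z^2 + B(P, D) z + N(D), with
    x^2 replaced by Tr(x) x - N(x). *)
Definition pencil_norm : A :=
  (oct_polar P D + oct_polar '1 x * oct_qnorm P) *: x +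
  (oct_qnorm D - oct_qnorm x * oct_qnorm P) *: '1.

(** Right multiplication by w multiplies norms by N(w), so N(D) and B(P, D) can
    be read off from D w = - P (w x). *)
Lemma pencil_norm_eq0 w :
  oct_division conj gamma -> w != 0 -> pencil w = 0 -> pencil_norm = 0.
Proof.
move=> divA w_neq0 /eqP; rewrite /pencil addrC addr_eq0 => /eqP Dw.
have Nw_neq0 : oct_qnorm w != 0.
  by apply: contra_neq w_neq0; apply: oct_qnorm_eq0.
have ND : oct_qnorm D = oct_qnorm P * oct_qnorm x.
  apply: (mulIf Nw_neq0); rewrite -[LHS]oct_qnormM Dw -scaleN1r.
  rewrite oct_qnormZ !oct_qnormM.
  by ring.
have BPD : oct_polar P D = - (oct_qnorm P * oct_polar '1 x).
  apply: (mulIf Nw_neq0); rewrite -[LHS]oct_polar_mulr Dw linearN /=.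
  rewrite oct_polar_mull -{1}[w]oct_mul1r oct_polar_mull.
  by ring.
rewrite /pencil_norm ND BPD.
rewrite [_ + _ * _]addrC mulrC subrr [_ * oct_qnorm x]mulrC subrr.
by rewrite !scale0r addr0.
Qed.

Lemma pencil_conj : pencil (cj P ** x + cj D) = pencil_norm.
Proof.
have DD : D ** cj D = oct_qnorm D *: '1.
  by rewrite -[X in D ** X]oct_mul1r oct_mulKr.
have PP : P ** cj P = oct_qnorm P *: '1.
  by rewrite -[X in P ** X]oct_mul1r oct_mulKr.
rewrite /pencil oct_mulDl oct_mulrr -scaleNr !oct_mulDr !oct_mulZr.
rewrite oct_mulKr PP DD !scalerA /pencil_norm mulNr scaleNr.
rewrite [(oct_qnorm D - _) *: _]scalerBl [(oct_polar P D + _) *: _]scalerDl.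
rewrite -oct_mulKrD.
by rewrite [LHS](AC (3*2)%AC ((3*4)*1*(5*2))%AC).
Qed.

(** When conj(P) x + conj(D) = 0, this confines the image of [pencil] to the
    span of x and 1. *)
Lemma pencilE y :
  pencil y + cj y ** (cj P ** x + cj D) =
  oct_polar P (cj y) *: x + oct_polar D (cj y) *: '1.
Proof.
rewrite /pencil oct_mulDr addrACA.
have := oct_mulKrD P (cj y) x; rewrite oct_conjK => ->; congr (_ + _).
by have := oct_mulKrD D (cj y) '1; rewrite oct_conjK !oct_mul1r.
Qed.

Lemma pencil_ker : (2 < \dim {: A})%N ->
  pencil_norm = 0 -> exists2 w, w != 0 & pencil w = 0.
Proof.
move=> dimA Phi0; have [w0|w_neq0] := eqVneq (cj P ** x + cj D) 0; last first.
  by exists (cj P ** x + cj D); rewrite ?pencil_conj.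
have lin_pencil : linear pencil.
  move=> k y z; rewrite /pencil oct_mulDl oct_mulZl !oct_mulDr !oct_mulZr.
  by rewrite scalerDr addrACA.
pose pencil_lin := GRing.isLinear.Build F A A *:%R pencil lin_pencil.
pose L : 'End(A) := linfun (HB.pack_for {linear A -> A} pencil pencil_lin).
have imL : (limg L <= <[x]> + <['1]>)%VS.
  apply/subvP=> _ /memv_imgP[y _ ->]; rewrite lfunE /=.
  have := pencilE y; rewrite w0 linear0 addr0 => ->.
  by rewrite memv_add // rpredZ ?memv_line.
have kerL : lker L != 0%VS.
  apply: contraTneq dimA => ker0; rewrite -leqNgt.
  rewrite -(limg_ker_dim L fullv) ker0 capv0 dimv0 add0n.
  apply: leq_trans (dimvS imL) _; apply: leq_trans (dimv_add_leqif _ _) _.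
  by rewrite !dim_vline; do 2!case: (_ != _).
exists (vpick (lker L)); first by rewrite vpick0.
by have := memv_pick (lker L); rewrite memv_ker lfunE => /eqP.
Qed.

End Pencil.

(** * Evaluation of the companion polynomial *)

Section CompanionPolynomial.
Variables (n : nat) (c : 'I_n -> A) (x : A).
Local Notation u := (monic_coef c).

(** The coefficients of the remainder (rem_lead) z + rem_const of the polynomial
    modulo the central polynomial z^2 - Tr(x) z + N(x). *)
Definition rem_lead : A := \sum_(j < n.+1) (exp_coef x j).1 *: u j.
Definition rem_const : A := \sum_(j < n.+1) (exp_coef x j).2 *: u j.

Lemma sum_monic_coef_exp w :
  \sum_(j < n.+1) u j ** (w ** oct_exp x j) = pencil rem_lead rem_const x w.
Proof.
rewrite /pencil !oct_mul_suml -big_split; apply: eq_bigr => j _.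
by rewrite oct_mul_exp oct_mulDr !oct_mulZr !oct_mulZl.
Qed.

(** The companion coefficients as elements of F. *)
Definition companion_coefF (k : nat) : F :=
  \sum_(i < n.+1) \sum_(j < n.+1 | (i < j)%N && (i + j == k)%N)
     oct_polar (u i) (u j)
  + (if odd k then 0 else oct_qnorm (u k./2)).

Lemma companion_coefE k : companion_coef c k = companion_coefF k *: '1.
Proof.
rewrite /companion_coef scalerDl scaler_suml; congr (_ + _).
  apply: eq_bigr => i _; rewrite scaler_suml; apply: eq_bigr => j _.
  exact: oct_polar_trace.
by case: ifP; rewrite ?scale0r // oct_normE.
Qed.

Lemma sum_even_index (g : nat -> F) m :
  \sum_(k < (2 * m).+1) (if odd k then 0 else g k) =
  \sum_(i < m.+1) g (2 * i)%N.
Proof.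
elim: m => [|m IHm]; first by rewrite !big_ord1.
rewrite mulnS !addSn add0n 2!big_ord_recr /= IHm.
by rewrite oddM /= addr0 [RHS]big_ord_recr /= mulnS.
Qed.

Lemma sum_companion_coefF (f : nat -> F) :
  \sum_(k < (2 * n).+1) companion_coefF k * f k =
  polarized_sum n.+1 u (fun i j => f (i + j)%N).
Proof.
under eq_bigr do rewrite mulrDl.
rewrite big_split /= addrC; congr (_ + _).
  transitivity (\sum_(k < (2 * n).+1)
      (if odd k then 0 else oct_qnorm (u k./2) * f k)).
    by apply: eq_bigr => k _; case: odd; rewrite ?mul0r.
  rewrite (sum_even_index (fun k => oct_qnorm (u k./2) * f k)).
  by apply: eq_bigr => i _; rewrite mul2n doubleK addnn.
under eq_bigr do rewrite mulr_suml.
rewrite exchange_big; apply: eq_bigr => i _ /=.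
under eq_bigr do rewrite mulr_suml big_mkcondr.
rewrite exchange_big; apply: eq_bigr => j /= lt_ij.
have lt_k : (i + j < (2 * n).+1)%N.
  by rewrite ltnS mul2n -addnn leq_add // -ltnS ltn_ord.
rewrite (bigD1 (Ordinal lt_k)) //= eqxx big1 ?addr0 // => k.
by rewrite -val_eqE eq_sym /= => /negbTE ->.
Qed.

Lemma companion_eval :
  \sum_(k < (2 * n).+1) companion_coef c k ** oct_exp x k =
  pencil_norm rem_lead rem_const x.
Proof.
pose a i := (exp_coef x i).1; pose d i := (exp_coef x i).2.
have aD i j :
    a (i + j)%N = a i * d j + d i * a j + oct_polar '1 x * (a i * a j).
  rewrite /a /d; have := exp_coefD x i j.
  by do 2!case: (exp_coef x _) => ? ?; move=> ->.
have dD i j : d (i + j)%N = d i * d j - oct_qnorm x * (a i * a j).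
  rewrite /a /d; have := exp_coefD x i j.
  by do 2!case: (exp_coef x _) => ? ?; move=> ->.
transitivity ((\sum_(k < (2 * n).+1) companion_coefF k * a k) *: x +
              (\sum_(k < (2 * n).+1) companion_coefF k * d k) *: '1).
  rewrite !scaler_suml -big_split; apply: eq_bigr => k _ /=.
  by rewrite companion_coefE oct_mulZl oct_mul1l oct_expE scalerDr !scalerA.
rewrite !sum_companion_coefF /pencil_norm.
have polarE : oct_polar rem_lead rem_const =
    polarized_sum n.+1 u (fun i j => a i * d j + d i * a j).
  rewrite /oct_polar -[rem_lead + _]big_split /=.
  under eq_bigr do rewrite -scalerDl.
  rewrite (oct_qnorm_sum _ (fun j => a j + d j)).
  rewrite (oct_qnorm_sum _ a) (oct_qnorm_sum _ d).
  rewrite addrAC -[LHS]addrC -mulN1r [X in _ + X]addrC.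
  rewrite -[X in _ + (X + _)]mulN1r.
  by rewrite -!polarized_sumP; apply: eq_polarized_sum => i j; ring.
have normE : oct_qnorm rem_lead = polarized_sum n.+1 u (fun i j => a i * a j).
  exact: oct_qnorm_sum.
rewrite polarE normE; congr (_ *: _ + _ *: _).
  rewrite addrC -polarized_sumP; apply: eq_polarized_sum => i j.
  by rewrite aD addrC.
rewrite [oct_qnorm rem_const](oct_qnorm_sum _ d) addrC -mulNr -polarized_sumP.
by apply: eq_polarized_sum => i j; rewrite dD; ring.
Qed.

End CompanionPolynomial.

(** * Right eigenvectors of the companion matrix *)

Section CompanionMatrix.
Variables (n : nat) (c : 'I_n -> A).
Implicit Types v : 'cV[A]_n.

Lemma companion_mul_lt v (i : 'I_n) (lt_i1 : (i.+1 < n)%N) :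
  oct_mulmxv (companion_mx c) v i 0 = v (Ordinal lt_i1) 0.
Proof.
rewrite mxE (bigD1 (Ordinal lt_i1)) //= mxE ltn_eqF // eqxx oct_mul1l.
rewrite big1 ?addr0 // => j; rewrite -val_eqE /= => /negbTE ne_j.
by rewrite mxE ltn_eqF // ne_j oct_mul0l.
Qed.

Lemma companion_mul_last v (i : 'I_n) : i.+1 = n ->
  oct_mulmxv (companion_mx c) v i 0 = - \sum_(j < n) c j ** v j 0.
Proof.
move=> i1; rewrite mxE -sumrN; apply: eq_bigr => j _.
by rewrite mxE i1 eqxx -scaleN1r oct_mulZl scaleN1r.
Qed.

Lemma sum_monic_coef (y : nat -> A) :
  \sum_(j < n.+1) monic_coef c j ** y j = \sum_(j < n) c j ** y j + y n.
Proof.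
rewrite big_ord_recr /=; congr (_ + _); last first.
  by rewrite /monic_coef insubF ?ltnn // eqxx oct_mul1l.
by apply: eq_bigr => j _; rewrite /monic_coef valK.
Qed.

Lemma right_eigenvalueP x : (0 < n)%N ->
  right_eigenvalues (companion_mx c) x <->
  exists2 w, w != 0 & \sum_(j < n.+1) monic_coef c j ** (w ** oct_exp x j) = 0.
Proof.
move=> n_gt0; split=> [[v v_neq0 Cv]|[w w_neq0]].
  have Cv_i i : oct_mulmxv (companion_mx c) v i 0 = v i 0 ** x.
    by rewrite Cv mxE.
  pose w := v (Ordinal n_gt0) 0.
  (* Each of the first n - 1 rows says that an entry of v is the preceding
     one multiplied by x on the right. *)
  have vE k (lt_k : (k < n)%N) : v (Ordinal lt_k) 0 = w ** oct_exp x k.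
    elim: k lt_k => [|k IHk] lt_k.
      by rewrite oct_mul1r /w; congr (v _ _); apply: val_inj.
    rewrite oct_mul_expSr -(IHk (ltnW lt_k)) -Cv_i.
    by rewrite (companion_mul_lt v (i := Ordinal (ltnW lt_k)) lt_k).
  have {}vE (i : 'I_n) : v i 0 = w ** oct_exp x i.
    by case: i => i lt_i; rewrite vE.
  exists w.
    apply: contra_neq v_neq0 => w0; apply/colP => i.
    by rewrite vE w0 oct_mul0l mxE.
  have lt_n1 : (n.-1 < n)%N by rewrite ltn_predL.
  have := Cv_i (Ordinal lt_n1); rewrite companion_mul_last ?prednK // vE.
  rewrite -oct_mul_expSr prednK //.
  rewrite (sum_monic_coef (fun j => w ** oct_exp x j)) => <-.
  by apply/eqP; rewrite subr_eq0; apply/eqP; apply: eq_bigr => j _; rewrite vE.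
rewrite (sum_monic_coef (fun j => w ** oct_exp x j)) addrC => /eqP.
rewrite addr_eq0 => /eqP w_root.
exists (\col_i (w ** oct_exp x i)).
  apply: contra_neq w_neq0 => /colP/(_ (Ordinal n_gt0)).
  by rewrite !mxE /= oct_mul1r.
apply/colP => i; rewrite [RHS]mxE mxE -oct_mul_expSr.
have [lt_i1|] := ltnP i.+1 n; first by rewrite companion_mul_lt mxE.
move=> le_n; have i1 : i.+1 = n by apply/eqP; rewrite eqn_leq le_n ltn_ord.
rewrite companion_mul_last // i1 w_root; congr (- _).
by apply: eq_bigr => j _; rewrite mxE.
Qed.

End CompanionMatrix.

End OctonionNorm.

Theorem corollary5p5 (F : fieldType) (Q : falgType F)
    (conj : {linear Q -> Q}) (gamma : F)
    (quatQ : is_quaternion_algebra Q)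
    (conjP : is_canonical_involution conj)
    (gamma_neq0 : gamma != 0)
    (divA : oct_division conj gamma)
    (n : nat) (n_gt0 : (0 < n)%N) (c : 'I_n -> octonion conj gamma) :
  companion_roots c = right_eigenvalues (companion_mx c).
Proof.
have dimA : (2 < \dim {: octonion conj gamma})%N.
  have [dimQ _ _] := quatQ; rewrite dimvf in dimQ.
  by rewrite dimvf -[dim _]/(dim Q + dim Q)%N dimQ.
apply/seteqP; split=> x.
  rewrite /companion_roots /= companion_eval // => Phi0.
  apply/(right_eigenvalueP conjP c x n_gt0).
  have [w w_neq0 pencil0] := pencil_ker conjP dimA Phi0.
  by exists w; rewrite ?sum_monic_coef_exp.
case/(right_eigenvalueP conjP c x n_gt0) => w w_neq0.
rewrite sum_monic_coef_exp // => pencil0.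
rewrite /companion_roots /= companion_eval //.
by apply: pencil_norm_eq0 pencil0.
Qed.
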